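(* Let $2\le p<\infty$ and $n\in\mathbb{N}=\{0,1,\dots\}$. Let $A\subset\mathbb{R}$ be compact, let $\nu$ be a positive and nontrivial Radon measure on $A$, let $\mathrm{d}\alpha(x)=\omega(x)\,\mathrm{d}\nu(x)$ with $\omega$ a positive weight (not depending on $t$), let $\jmath>0$ be a constant, let $U\subset\mathbb{R}$ be an open interval, let $y:U\to\mathbb{R}$ be continuously differentiable, and let $$\mathrm{d}\mu(x,t)=\mathrm{d}\alpha(x)+\jmath\,\delta_{y(t)}\qquad(t\in U).$$ Let $P_{n+1,p}(x,t)$ be the monic polynomial of degree $n+1$ of minimal $L^p(\mu(\cdot,t))$-norm. Define the sets $$B_-:=\{t\in U \mid y(t)\in \mathrm{Co}(A)^c \text{ and } y'(t)<0\},\qquad B_+:=\{t\in U \mid y(t)\in \mathrm{Co}(A)^c \text{ and } y'(t)>0\}.$$ Then all the zeros of $P_{n+1,p}(x,t)$ are strictly decreasing functions of $t$ on $B_-$, and all the zeros of $P_{n+1,p}(x,t)$ are strictly increasing functions of $t$ on $B_+$.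
   Context: For a positive nontrivial Radon measure $\mu$ on $\mathbb{R}$ with compact support (nontrivial meaning that its support is an infinite set) and $1<p<\infty$, $\|f\|_p=\left(\int|f|^p\,\mathrm{d}\mu\right)^{1/p}$. The monic polynomial $P_{n+1,p}$ of degree $n+1$ is the unique minimizer of $\|\cdot\|_p$ among all monic real polynomials of degree $n+1$; equivalently, $P_{n+1,p}(x)=x^{n+1}-g_0(x)$, where $g_0$ is the best $L^p(\mu)$-approximation to $x^{n+1}$ from the real polynomials of degree at most $n$. Its zeros are real, simple, and lie in the convex hull of $\operatorname{supp}(\mu)$. When $\mu=\mu(\cdot,t)$ depends on a parameter $t$, this polynomial is denoted $P_{n+1,p}(x,t)$, and its zeros are labelled $x_0(t)<\dots<x_n(t)$, so that each $x_k$ is a function of $t$. $\delta_y$ is the Dirac measure with support $\{y\}$, $\mathrm{Co}(A)$ is the convex hull of $A$, and $S^c=\mathbb{R}\setminus S$ for $S\subset\mathbb{R}$.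
   Formalization: ''Strictly decreasing on B_-'' and ''strictly increasing on B_+'' are meant on each interval contained in B_- or B_+; across different components of these sets the claim fails in general, since y may move back in between. *)

(* Defs.v *)
From HB Require Import structures.
From mathcomp Require Import all_boot all_order all_algebra.
From mathcomp Require Import all_classical all_reals all_analysis.

Set Implicit Arguments.
Unset Strict Implicit.
Unset Printing Implicit Defensive.

Import Order.TTheory GRing.Theory Num.Theory.
Import numFieldNormedType.Exports.

Local Open Scope classical_set_scope.
Local Open Scope ring_scope.

Notation borel_measure R := {measure set (measurableTypeR R) -> \bar R}.

(* On the real line a Borel measure that is finite on compact sets is
   automatically inner and outer regular, so no regularity clause is needed. *)
Definition radon (R : realType) (mu : borel_measure R) : Prop :=
  forall K : set R, compact K -> (mu K < +oo)%E.

Definition supp (R : realType) (mu : borel_measure R) : set R :=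
  [set x : R | forall V : set R, open V -> V x -> (0 < mu V)%E].

(* A measure on A is a Borel measure on the line giving no mass to the
   complement of A. *)
Definition nontrivial_radon_on (R : realType) (A : set R)
    (mu : borel_measure R) : Prop :=
  [/\ radon mu, mu (~` A) = 0%E & infinite_set (supp mu)].

(* d alpha = omega d nu, where the weight omega is only meaningful on A *)
Definition has_density (R : realType) (A : set R) (nu : borel_measure R)
    (omega : R -> R) (alpha : borel_measure R) : Prop :=
  forall E : set (measurableTypeR R), measurable E ->
    alpha E = (\int[nu]_(x in E `&` A) (omega x)%:E)%E.

Definition add_mass (R : realType) (alpha : borel_measure R)
    (j : {posnum R}) (a : R) : borel_measure R :=
  measure_add alpha (mscale (j%:num)%:nng (dirac (a : measurableTypeR R))).

Definition convex_hull (R : realType) (A : set R) : set R :=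
  smallest (@convex_set R R^o) A.

Definition poly_Lp_norm (R : realType) (mu : borel_measure R) (p : R)
    (Q : {poly R}) : \bar R :=
  'N[mu]_(p%:E)[(fun x : measurableTypeR R => (Q.[x])%:E)].

Definition minimal_monic (R : realType) (mu : borel_measure R) (p : R)
    (d : nat) (Q : {poly R}) : Prop :=
  [/\ Q \is monic, size Q = d.+1
    & forall Q' : {poly R}, Q' \is monic -> size Q' = d.+1 ->
        (poly_Lp_norm mu p Q <= poly_Lp_norm mu p Q')%E].

Definition ordered_zeros (R : realType) (n : nat) (Q : {poly R})
    (x : 'I_n -> R) : Prop :=
  (forall i j : 'I_n, (i < j)%N -> x i < x j) /\
  (forall z : R, root Q z <-> exists i : 'I_n, z = x i).

Definition C1_on (R : realType) (U : set R) (y : R -> R) : Prop :=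
  (forall t, U t -> derivable y t 1) /\ {within U, continuous (derive1 y)}.

Definition Bminus (R : realType) (A U : set R) (y : R -> R) : set R :=
  [set t | [/\ U t, (~` convex_hull A) (y t) & derive1 y t < 0]].

Definition Bplus (R : realType) (A U : set R) (y : R -> R) : set R :=
  [set t | [/\ U t, (~` convex_hull A) (y t) & 0 < derive1 y t]].

(* Monotonicity on every interval contained in B, i.e. on every connected
   component of B.  Across components it can fail: a function whose derivative
   is negative on B may increase between two components of B. *)
Definition strictly_increasing_on (R : realType) (B : set R) (f : R -> R) :=
  forall I : set R, is_interval I -> I `<=` B ->
    forall s t, I s -> I t -> s < t -> f s < f t.

Definition strictly_decreasing_on (R : realType) (B : set R) (f : R -> R) :=
  forall I : set R, is_interval I -> I `<=` B ->
    forall s t, I s -> I t -> s < t -> f t < f s.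

(* Main.v *)
Require Import Defs.
From HB Require Import structures.
From mathcomp Require Import all_boot all_order all_algebra.
From mathcomp Require Import all_classical all_reals all_analysis.
From mathcomp Require Import measurable_realfun.
From mathcomp Require Import ring lra zify.

Set Implicit Arguments.
Unset Strict Implicit.
Unset Printing Implicit Defensive.

Import Order.TTheory GRing.Theory Num.Theory.
Import numFieldNormedType.Exports.

(** On an interval contained in B_+ or B_- the function y is strictly monotone
and, by the intermediate value theorem, stays on one side of A.  So everything
reduces to comparing two positions a < b of the point mass on the same side of
A: the zeros of the extremal polynomial P for a must lie strictly to the left
of the corresponding zeros of the extremal polynomial Q for b.

Write phi u = u |u|^(p-2) and let the masses lie to the right of A.  Extremality
means orthogonality: the integral of q phi(P) against alpha + j delta_a vanishes
for every q of degree at most n, and likewise for Q and b.  As phi is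
multiplicative and increasing, combining the two relations gives, for all reals
c, d, that whenever q (c Q - d P) >= 0 on A,
   q(b) phi(c Q(b)) <= q(a) phi(d P(a)),
strictly unless q or c Q - d P is zero (minimal_mass_inequality).  The rest is
algebra of polynomials, with well chosen q (zeros_lt_masses_right).

The central point is that the Wronskian P' Q - P Q' has no real zero
(wronskian_neq0): at a zero xi some member c Q - P of the pencil would be
(X - xi)^2 G with deg G < n, and two degrees are then free to build a q of the
sign of G on A that also controls the two mass terms.  A Wronskian of constant
sign forces the zeros of P and Q to interlace strictly (interlace_lt), so either
every zero of P precedes the corresponding zero of Q, or every zero follows it.
In the second case Q > P to the right of the zeros of P, and a q with the sign
of Q - P contradicts the inequality.  Masses to the left of A are handled by the
reflection x -> -x. *)

(** * Zeros, signs and interlacing *)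

Local Open Scope ring_scope.

Lemma card_set_sum (T : finType) (P : pred T) :
  #|[set i | P i]| = (\sum_i P i)%N.
Proof.
by rewrite -sum1_card big_mkcond; apply: eq_bigr => i _; rewrite inE; case: (P i).
Qed.

Lemma card_ord_gt (n : nat) (k : 'I_n.+1) :
  #|[set i : 'I_n.+1 | (k < i)%N]| = (n - k)%N.
Proof.
rewrite card_set_sum -(big_mkord xpredT (fun i => nat_of_bool (k < i)%N)).
rewrite (big_cat_nat (n := k.+1)) //= big_nat_cond big1 ?add0n; last first.
  by move=> i /andP[]; lia.
rewrite big_nat_cond (eq_bigr (fun=> 1%N)); last by move=> i; lia.
by rewrite -big_nat_cond sum_nat_const_nat muln1 subSS.
Qed.

Lemma sgr_prod_subr (R : realDomainType) (m : nat) (z : 'I_m -> R) (u : R) :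
  (forall i, u != z i) ->
  Num.sg (\prod_i (u - z i)) = (-1) ^+ #|[set i | u < z i]|.
Proof.
move=> uz; rewrite (big_morph _ (@sgrM R) (@sgr1 R)) card_set_sum -prodrXr.
apply: eq_bigr => i _; case: ltgtP (uz i) => // h _.
- by rewrite ltr0_sg ?subr_lt0.
- by rewrite gtr0_sg ?subr_gt0.
Qed.

Lemma horner_prod_sub (R : comNzRingType) (m : nat) (z : 'I_m -> R) (u : R) :
  (\prod_i ('X - (z i)%:P)).[u] = \prod_i (u - z i).
Proof. by rewrite horner_prod; apply: eq_bigr => i _; rewrite hornerXsubC. Qed.

Lemma size_prod_sub (R : nzRingType) (m : nat) (z : 'I_m -> R) :
  size (\prod_i ('X - (z i)%:P)) = m.+1.
Proof. by rewrite size_prod_XsubC [index_enum _]unlock -enumT size_enum_ord. Qed.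

Lemma deriv_prod_sub (R : comNzRingType) (m : nat) (z : 'I_m -> R) (k : 'I_m) :
  (\prod_i ('X - (z i)%:P))^`().[z k] = \prod_(i | i != k) (z k - z i).
Proof.
rewrite (bigD1 k) //= derivM derivXsubC mul1r hornerD hornerM hornerXsubC.
rewrite subrr mul0r addr0 horner_prod.
by apply: eq_bigr => i _; rewrite hornerXsubC.
Qed.

Section Interlace.
Variables (R : realDomainType) (n : nat) (x z : 'I_n.+1 -> R).
Hypotheses (xi : forall i j : 'I_n.+1, (i < j)%N -> x i < x j).
Hypotheses (zi : forall i j : 'I_n.+1, (i < j)%N -> z i < z j).
Let P := \prod_i ('X - (x i)%:P).
Let Q := \prod_i ('X - (z i)%:P).

Lemma sg_deriv_prod_sub (k : 'I_n.+1) : Num.sg P^`().[x k] = (-1) ^+ (n - k).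
Proof.
rewrite deriv_prod_sub (big_morph _ (@sgrM R) (@sgr1 R)).
rewrite -(card_ord_gt k) card_set_sum -prodrXr [RHS](bigD1 k) //= ltnn mul1r.
apply: eq_bigr => i; rewrite -val_eqE /= neq_ltn => /orP[ik|ki].
  by rewrite gtr0_sg ?subr_gt0 ?xi // ltnNge ltnW.
by rewrite ltr0_sg ?subr_lt0 ?xi // ki.
Qed.

(** The hypothesis says that at the zeros of P the Wronskian P' Q - P Q' is
negative.  The sign of P' at x_k is (-1)^(n-k), so the number N_k of zeros of Q
to the right of x_k has the parity of n - k + 1.  As N_n is odd, and N_k does
not increase with k but changes parity at each step, N_k >= n - k + 1, which
leaves no room for z_k to be at most x_k. *)
Lemma interlace_lt : (forall k, P^`().[x k] * Q.[x k] < 0) ->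
  forall k, x k < z k.
Proof.
move=> W k.
pose N k := #|[set i | x k < z i]|.
have Qx0 i : Q.[x i] != 0.
  by apply: contraTneq (W i) => ->; rewrite mulr0 ltxx.
have oddN i : odd (N i) = ~~ odd (n - i).
  have := W i; rewrite -sgr_cp0 sgrM sg_deriv_prod_sub horner_prod_sub.
  rewrite sgr_prod_subr; last first.
    move=> l; apply: contra (Qx0 i) => /eqP xz.
    by rewrite horner_prod_sub xz (bigD1 l) //= subrr mul0r.
  rewrite -/(N i) -exprD -signr_odd oddD.
  have n11 : (1 == -1 :> R) = false by rewrite gt_eqF // (lt_trans (ltrN10 R) ltr01).
  by case: (odd (n - i)); case: (odd (N i)); rewrite //= expr0 n11.
have Nge m (i : 'I_n.+1) : (n - i = m)%N -> (m < N i)%N.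
  elim: m i => [|m IH] i im; first by move: (oddN i); rewrite im; case: (N i).
  have i1 : (i.+1 < n.+1)%N by lia.
  have := IH (Ordinal i1); rewrite /= subnS im => /(_ erefl) Ni1.
  have : (N (Ordinal i1) <= N i)%N.
    apply: subset_leq_card; apply/fintype.subsetP => l; rewrite !inE.
    by apply: lt_trans; apply: xi.
  move: (oddN i) (oddN (Ordinal i1)); rewrite /= subnS im /=.
  by rewrite negbK => e1 e2; lia.
rewrite ltNge; apply/negP => zx.
have := Nge _ k erefl; rewrite ltnNge => /negP; apply.
apply: (@leq_trans #|[set i : 'I_n.+1 | (k < i)%N]|).
  apply: subset_leq_card; apply/fintype.subsetP => l; rewrite !inE ltnNge.
  apply: contraTN => lk; rewrite -leNgt; apply: le_trans zx.
  by move: lk; rewrite leq_eqVlt => /orP[/eqP/val_inj->//|/zi/ltW].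
by rewrite card_ord_gt.
Qed.
End Interlace.

(** The polynomial r collects, with multiplicity, the zeros of G in ]-oo, M].
Each linear factor enters r G as a square, and the cofactor of r in G has
constant sign on the half-line.  All zeros of r being at most M, r is
nonnegative and nondecreasing beyond M. *)
Lemma sign_matching (R : rcfType) (M : R) (G : {poly R}) : G != 0 ->
  exists r : {poly R},
  [/\ r %| G, forall u, M < u -> 0 < r.[u],
      forall u v, M <= u -> u <= v -> 0 <= r.[u] <= r.[v] &
      (forall u, u <= M -> 0 <= r.[u] * G.[u]) \/
      (forall u, u <= M -> r.[u] * G.[u] <= 0)].
Proof.
move: {2}(size G) (leqnn (size G)) => m; elim: m G => [|m IH] G.
  by rewrite leqn0 size_poly_eq0 => ->.
move=> sG G0.
have [[r rM rG]|noroot] := pselect (exists2 r, r <= M & root G r).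
  have [H GE] := factor_theorem _ _ rG.
  have H0 : H != 0 by apply: contraNneq G0; rewrite GE => ->; rewrite mul0r.
  have sH : (size H <= m)%N.
    by move: sG; rewrite GE size_Mmonic ?monicXsubC // size_XsubC addn2.
  have [s [sH' s1 s2 s3]] := IH _ sH H0.
  exists (s * ('X - r%:P)); split.
  - by rewrite GE dvdp_mul2r ?polyXsubC_eq0.
  - by move=> u Mu; rewrite hornerM hornerXsubC mulr_gt0 ?s1 //
      subr_gt0 (le_lt_trans rM).
  - move=> u v Mu uv; rewrite !hornerM !hornerXsubC.
    have /andP[su suv] := s2 u v Mu uv.
    have ru : r <= u by apply: le_trans Mu.
    by rewrite mulr_ge0 ?subr_ge0 //= ler_pM ?subr_ge0 // lerD2r.
  - have E u : (s * ('X - r%:P)).[u] * G.[u] = s.[u] * H.[u] * (u - r) ^+ 2.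
      by rewrite GE !hornerM !hornerXsubC; ring.
    case: s3 => s3; [left|right] => u uM; rewrite E.
      by rewrite mulr_ge0 ?s3 ?sqr_ge0.
    by rewrite mulr_le0_ge0 ?s3 ?sqr_ge0.
exists 1; split; rewrite ?dvd1p //.
- by move=> u _; rewrite hornerC.
- by move=> u v _ _; rewrite !hornerC lexx ler01.
have GM u : u <= M -> G.[u] != 0.
  by move=> uM; apply/negP => r; apply: noroot; exists u.
have [M0|M0|/eqP] := ltgtP 0 G.[M]; last by rewrite eq_sym (negPf (GM _ (lexx _))).
- left=> u uM; rewrite hornerC mul1r leNgt; apply/negP => u0; apply: noroot.
  have [|v /andP[_ vM] rv] := @poly_ivt _ G u M uM; first by rewrite !ltW.
  by exists v.
- right=> u uM; rewrite hornerC mul1r leNgt; apply/negP => u0; apply: noroot.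
  have [|v /andP[_ vM] rv] := @poly_ivt _ (- G) u M uM.
    by rewrite !hornerN oppr_le0 oppr_ge0 !ltW.
  by exists v; rewrite // -rootN.
Qed.

(** * Comparison of two polynomials satisfying the mass inequality *)

(** What the orthogonality relations of P (mass at a) and Q (mass at b) say
about polynomials alone, once the measure carried by S has been eliminated: its
contribution, the integral of q (phi(c Q) - phi(d P)), has the sign of
q (c Q - d P). *)
Definition mass_inequality (R : numDomainType) (n : nat) (phi : R -> R)
    (S : R -> Prop) (P Q : {poly R}) (a b : R) :=
  forall (c d : R) (q : {poly R}), (size q <= n.+1)%N ->
  (forall u, S u -> 0 <= q.[u] * (c * Q.[u] - d * P.[u])) ->
  q.[b] * phi (c * Q.[b]) <= q.[a] * phi (d * P.[a]) /\
  (q != 0 -> c *: Q - d *: P != 0 ->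
   q.[b] * phi (c * Q.[b]) < q.[a] * phi (d * P.[a])).

Section MassesOnTheRight.
Variables (R : rcfType) (n : nat) (phi : R -> R).
Hypotheses (phi_mono : {mono phi : u v / u <= v}) (phi0 : phi 0 = 0).
Variables (x z : 'I_n.+1 -> R) (a b : R).
Hypotheses (xi : forall i j : 'I_n.+1, (i < j)%N -> x i < x j).
Hypotheses (zi : forall i j : 'I_n.+1, (i < j)%N -> z i < z j).
Hypothesis ab : a < b.
Let P := \prod_i ('X - (x i)%:P).
Let Q := \prod_i ('X - (z i)%:P).
Hypothesis key : mass_inequality n phi (fun u => u < a) P Q a b.

Let phi_ge0 u : (0 <= phi u) = (0 <= u).
Proof. by rewrite -{1}phi0 phi_mono. Qed.

Let phi_le0 u : (phi u <= 0) = (u <= 0).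
Proof. by rewrite -{1}phi0 phi_mono. Qed.

Let mul_phi_ge0 s t : 0 <= t -> 0 <= s * phi (t * s).
Proof.
move=> t0; have [s0|s0] := leP 0 s.
  by rewrite mulr_ge0 // phi_ge0 mulr_ge0.
by rewrite mulr_le0 ?(ltW s0) // phi_le0 mulr_ge0_le0 // ltW.
Qed.

Let prod_rem (w : 'I_n.+1 -> R) k : exists S : {poly R},
  [/\ S \is monic, size S = n.+1 & \prod_i ('X - (w i)%:P) = ('X - (w k)%:P) * S].
Proof.
exists (\prod_(i | i != k) ('X - (w i)%:P)).
have E : \prod_i ('X - (w i)%:P) =
    ('X - (w k)%:P) * \prod_(i | i != k) ('X - (w i)%:P) by rewrite (bigD1 k).
have mS : \prod_(i | i != k) ('X - (w i)%:P) \is monic by rewrite monic_prod_XsubC.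
split => //; apply: succn_inj.
transitivity (size (\prod_i ('X - (w i)%:P))).
  by rewrite E size_monicM ?monicXsubC ?monic_neq0 // size_XsubC.
by rewrite size_prod_sub.
Qed.

(** With c = 0 and d = -1 only P is left.  If x_k >= a, then q = - P / (X - x_k)
satisfies q P >= 0 to the left of a and makes the mass term have the wrong
sign. *)
Lemma fst_zeros_lt_mass k : x k < a.
Proof.
rewrite ltNge; apply/negP => ax.
have [S [mS sS PE]] := prod_rem x k; rewrite -/P in PE.
have [||_] := key (c := 0) (d := -1) (q := - S).
- by rewrite size_polyN sS.
- move=> u uM; rewrite PE hornerN hornerM hornerXsubC.
  have -> : - S.[u] * (0 * Q.[u] - -1 * ((u - x k) * S.[u])) =
    S.[u] ^+ 2 * (x k - u) by ring.
  by rewrite mulr_ge0 ?sqr_ge0 // subr_ge0 (le_trans (ltW uM)).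
rewrite scale0r sub0r scaleN1r opprK oppr_eq0 monic_neq0 // => /(_ isT).
have P0 : P != 0 by rewrite monic_neq0 // monic_prod_XsubC.
move=> /(_ P0); rewrite mul0r phi0 mulr0 hornerN PE hornerM hornerXsubC.
rewrite mulrA mulN1r opprB mulNr oppr_gt0 ltNge => /negP; apply.
by rewrite mul_phi_ge0 // subr_ge0.
Qed.

Lemma snd_zeros_lt_mass k : z k < b.
Proof.
rewrite ltNge; apply/negP => bz.
have [S [mS sS QE]] := prod_rem z k; rewrite -/Q in QE.
have [||_] := key (c := -1) (d := 0) (q := S); first by rewrite sS.
  move=> u uM; rewrite QE hornerM hornerXsubC.
  have -> : S.[u] * (-1 * ((u - z k) * S.[u]) - 0 * P.[u]) =
    S.[u] ^+ 2 * (z k - u) by ring.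
  by rewrite mulr_ge0 ?sqr_ge0 // subr_ge0 ltW // (lt_le_trans _ bz) // (lt_trans uM).
rewrite scale0r subr0 scaleN1r oppr_eq0 monic_neq0 // => /(_ isT).
have Q0 : Q != 0 by rewrite monic_neq0 // monic_prod_XsubC.
move=> /(_ Q0); rewrite mul0r phi0 mulr0 QE hornerM hornerXsubC.
rewrite mulrA mulN1r opprB ltNge => /negP; apply.
by rewrite mul_phi_ge0 // subr_ge0.
Qed.

Let Pa_gt0 : 0 < P.[a].
Proof.
rewrite horner_prod_sub; apply: prodr_gt0 => i _.
by rewrite subr_gt0 fst_zeros_lt_mass.
Qed.

Let Qb_gt0 : 0 < Q.[b].
Proof.
rewrite horner_prod_sub; apply: prodr_gt0 => i _.
by rewrite subr_gt0 snd_zeros_lt_mass.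
Qed.

Let PaPb : P.[a] < P.[b].
Proof.
rewrite !horner_prod_sub; apply: ltr_prod.
  by apply/hasP; exists ord0; rewrite ?mem_index_enum.
by move=> i _; rewrite ltrD2r ab subr_ge0 ltW // fst_zeros_lt_mass.
Qed.

Let simple_zeros (w : 'I_n.+1 -> R) u :
  (forall i j : 'I_n.+1, (i < j)%N -> w i < w j) ->
  let F := \prod_i ('X - (w i)%:P) in F.[u] = 0 -> F^`().[u] != 0.
Proof.
move=> wi F /eqP; rewrite horner_prod_sub => /prodf_eq0[k _].
rewrite subr_eq0 => /eqP->; have := sg_deriv_prod_sub wi k.
by apply: contra_eq_neq => ->; rewrite sgr0 eq_sym signr_eq0.
Qed.

(** A zero u of the Wronskian makes the vectors (P, P') and (Q, Q') at u
proportional; simplicity of the zeros of P and Q makes the factor finite and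
nonzero. *)
Let pencil_double_zero u : (P^`() * Q - P * Q^`()).[u] = 0 ->
  exists c : R, exists2 G : {poly R}, c != 0 & c *: Q - P = ('X - u%:P) ^+ 2 * G.
Proof.
rewrite hornerD hornerN !hornerM => W0.
suff [c c0 [c1 c2]] : exists2 c : R, c != 0 &
    c * Q.[u] = P.[u] /\ c * Q^`().[u] = P^`().[u].
  exists c; have /factor_theorem[T TE] : root (c *: Q - P) u.
    by rewrite rootE hornerD hornerN hornerZ c1 subrr.
  have /factor_theorem[G GE] : root T u.
    have : (c *: Q - P)^`().[u] = 0.
      by rewrite derivB derivZ hornerD hornerN hornerZ c2 subrr.
    rewrite TE derivM hornerD !hornerM hornerXsubC derivXsubC subrr mulr0 add0r.
    by rewrite hornerC mulr1 => /rootP.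
  by exists G => //; rewrite TE GE expr2; ring.
have [Q0|Q0] := eqVneq Q.[u] 0.
  have Q'0 := simple_zeros zi Q0.
  have P0 : P.[u] = 0.
    move: W0; rewrite Q0 mulr0 sub0r => /eqP; rewrite oppr_eq0 mulf_eq0.
    by rewrite (negPf Q'0) orbF => /eqP.
  have P'0 := simple_zeros xi P0.
  exists (P^`().[u] / Q^`().[u]); first by rewrite mulf_neq0 // invr_eq0.
  by rewrite Q0 P0 mulr0 divfK.
have P0 : P.[u] != 0.
  apply/eqP => P0; have P'0 := simple_zeros xi P0.
  move/eqP: W0; rewrite P0 mul0r subr0 mulf_eq0 (negPf Q0) (negPf P'0) //.
exists (P.[u] / Q.[u]); first by rewrite mulf_neq0 // invr_eq0.
split; first by rewrite divfK.
apply: (mulIf Q0); rewrite mulrAC divfK //; apply/esym/eqP.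
by rewrite -subr_eq0 W0.
Qed.

(** Let c Q - P = (X - u)^2 G, so that deg G < n, and let r match the sign of G
to the left of a.  A multiple of r or of G by a polynomial of degree at most one
is then a q contradicting the mass inequality.
- If r G <= 0, q = r (X - b) kills the mass term at b.
- If r G >= 0 and c < 0, q = - r (X - a) kills the mass term at a.
- If r G >= 0 and c Q(b) >= P(a), q = r works because r(b) >= r(a).
- Otherwise c Q(b) < P(a) < P(b), so G(b) < 0 and q = - G (X - a) works. *)
Lemma wronskian_neq0 u : (P^`() * Q - P * Q^`()).[u] != 0.
Proof.
apply/eqP => /pencil_double_zero [c [G c0 HE]].
have hE v : c * Q.[v] - 1 * P.[v] = (v - u) ^+ 2 * G.[v].
  have := congr1 (horner^~ v) HE; rewrite /= mul1r hornerD hornerN hornerZ.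
  by rewrite hornerM horner_exp hornerXsubC.
have H0 : c *: Q - 1 *: P != 0.
  (* If c Q = P, the constant q = 1 gives P(b) <= P(a). *)
  apply/eqP => H0.
  have hv v : c * Q.[v] = P.[v].
    apply/eqP; rewrite -subr_eq0; have := congr1 (horner^~ v) H0.
    by rewrite /= hornerD hornerN !hornerZ mul1r horner0 => ->.
  have [||+ _] := key (c := c) (d := 1) (q := 1).
  - by rewrite size_poly1.
  - by move=> v _; rewrite hv mul1r subrr mulr0.
  by rewrite !hornerC !mul1r hv phi_mono leNgt PaPb.
have G0 : G != 0.
  by apply: contraNneq H0 => G0; rewrite scale1r HE G0 mulr0.
have sG : (size G <= n)%N.
  have : (size (c *: Q - P)%R <= n.+2)%N.
    rewrite (leq_trans (size_polyD _ _)) // geq_max size_polyN /P size_prod_sub.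
    by rewrite leqnn andbT (leq_trans (size_scale_leq _ _)) // /Q size_prod_sub.
  by rewrite HE size_monicM ?monic_exp ?monicXsubC // size_exp_XsubC.
have [r [rG r1 r2 r3]] := sign_matching a G0.
have r0 : r != 0 by apply: contraTneq (r1 _ ab) => ->; rewrite horner0 ltxx.
have sr : (size r <= n)%N by rewrite (leq_trans _ sG) // dvdp_leq.
have /andP[ra rab] := r2 _ _ (lexx a) (ltW ab); have rb := r1 _ ab.
have sM (s : {poly R}) v : s != 0 -> (size s <= n)%N ->
    [/\ (size (s * ('X - v%:P))%R <= n.+1)%N & s * ('X - v%:P) != 0].
  move=> s0 sn; rewrite size_Mmonic ?monicXsubC // size_XsubC addn2.
  by rewrite mulf_neq0 // polyXsubC_eq0.
case: r3 => r3; last first.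
  have [s1 s2] := sM r b r0 sr.
  have [//||_ /(_ s2 H0)] := key (c := c) (d := 1) (q := r * ('X - b%:P)).
    move=> v vM; rewrite hE hornerM hornerXsubC mulrCA mulr_ge0 ?sqr_ge0 //.
    by rewrite mulrAC mulr_le0 ?r3 ?(ltW vM) // subr_le0 ltW // (lt_trans vM).
  rewrite !hornerM !hornerXsubC subrr mulr0 mul0r mul1r ltNge => /negP; apply.
  by rewrite mulr_le0_ge0 ?phi_ge0 ?(ltW Pa_gt0) // mulr_ge0_le0 // subr_le0 ltW.
have [s1 s2] : [/\ (size (- r * ('X - a%:P))%R <= n.+1)%N & - r * ('X - a%:P) != 0].
  by apply: sM; rewrite ?oppr_eq0 ?size_polyN.
have [c_lt0|c_gt0|c00] := ltgtP c 0; last by rewrite c00 eqxx in c0.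
  have [//||_ /(_ s2 H0)] := key (c := c) (d := 1) (q := - r * ('X - a%:P)).
    move=> v vM; rewrite hE hornerM hornerXsubC mulrCA mulr_ge0 ?sqr_ge0 //.
    by rewrite mulrAC mulr_le0 ?hornerN ?mulNr ?oppr_le0 ?r3 ?(ltW vM) //
      subr_le0 ltW.
  rewrite !hornerM !hornerXsubC subrr mulr0 mul0r hornerN ltNge => /negP; apply.
  rewrite mulr_le0 // ?phi_le0; last by rewrite pmulr_lle0 // ltW.
  by rewrite mulNr oppr_le0 mulr_ge0 ?(ltW rb) // subr_ge0 ltW.
have [Qc|Qc] := leP P.[a] (c * Q.[b]).
  have [||_ /(_ r0 H0)] := key (c := c) (d := 1) (q := r).
  - by rewrite ltnW.
  - by move=> v vM; rewrite hE mulrCA mulr_ge0 ?sqr_ge0 // r3 // ltW.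
  rewrite mul1r ltNge => /negP; apply.
  by rewrite ler_pM ?phi_ge0 ?(ltW Pa_gt0) ?phi_mono.
have Gb : G.[b] < 0.
  have : (b - u) ^+ 2 * G.[b] < 0 by rewrite -hE mul1r subr_lt0 (lt_trans Qc).
  by apply: contraTT; rewrite -!leNgt => ?; rewrite mulr_ge0 ?sqr_ge0.
have [t1 t2] : [/\ (size (- G * ('X - a%:P))%R <= n.+1)%N & - G * ('X - a%:P) != 0].
  by apply: sM; rewrite ?oppr_eq0 ?size_polyN.
have [//||_ /(_ t2 H0)] := key (c := c) (d := 1) (q := - G * ('X - a%:P)).
  move=> v vM; rewrite hE hornerM hornerN hornerXsubC.
  have -> : - G.[v] * (v - a) * ((v - u) ^+ 2 * G.[v]) =
    (a - v) * (G.[v] * (v - u)) ^+ 2 by ring.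
  by rewrite mulr_ge0 ?sqr_ge0 // subr_ge0 ltW.
rewrite !hornerM !hornerXsubC subrr mulr0 mul0r hornerN ltNge => /negP; apply.
rewrite mulr_ge0 ?phi_ge0 ?mulr_ge0 ?(ltW c_gt0) ?(ltW Qb_gt0) //.
  by rewrite oppr_ge0 ltW.
by rewrite subr_ge0 ltW.
Qed.

(** The Wronskian has constant sign.  If it is negative, interlacing concludes.
If it is positive, the roles of P and Q are exchanged and z_i < x_i for all i;
then Q(a) > P(a) and Q(b) > P(b) > P(a), and the polynomial r matching the sign
of Q - P to the left of a contradicts the mass inequality, because
0 <= r(a) <= r(b). *)
Theorem zeros_lt_masses_right k : x k < z k.
Proof.
have W u : (P^`() * Q - P * Q^`()).[u] != 0 := wronskian_neq0 u.
set w := P^`() * Q - P * Q^`() in W.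
have wsgn u v : 0 < w.[u] -> w.[v] < 0 -> False.
  move=> wu wv; have [uv|/ltW vu] := leP u v.
    have [|t _] := @poly_ivt _ (- w) u v uv; last first.
      by rewrite rootN rootE (negPf (W t)).
    by rewrite !hornerN oppr_le0 oppr_ge0 !ltW.
  have [|t _] := @poly_ivt _ w v u vu; last by rewrite rootE (negPf (W t)).
  by rewrite !ltW.
have root_prod (y : 'I_n.+1 -> R) i : (\prod_i ('X - (y i)%:P)).[y i] = 0.
  by have [S [_ _ ->]] := prod_rem y i; rewrite hornerM hornerXsubC subrr mul0r.
have wx i : w.[x i] = P^`().[x i] * Q.[x i].
  by rewrite /w hornerD hornerN !hornerM root_prod mul0r subr0.
have wz i : w.[z i] = - (Q^`().[z i] * P.[z i]).
  by rewrite /w hornerD hornerN !hornerM root_prod mulr0 sub0r mulrC.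
have [w0|w0] := ltP w.[a] 0.
  apply: interlace_lt => // i; rewrite -/P -/Q -wx.
  by have := W (x i); case: ltgtP => // /wsgn /(_ w0).
have zx i : z i < x i.
  apply: interlace_lt => // l; rewrite -/P -/Q -[_ * _]opprK -wz oppr_lt0.
  have := W (z l); case: ltgtP => // wl _.
  by have : 0 < w.[a]; [rewrite lt_def W w0|move=> /wsgn /(_ wl)].
have PQ u : (forall i, x i < u) -> P.[u] < Q.[u].
  move=> xu; rewrite !horner_prod_sub; apply: ltr_prod.
    by apply/hasP; exists ord0; rewrite ?mem_index_enum.
  by move=> i _; rewrite ltrD2l ltrN2 zx subr_ge0 ltW.
have Ha : 0 < (Q - P).[a].
  by rewrite hornerD hornerN subr_gt0 PQ // => i; apply: fst_zeros_lt_mass.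
have PaQb : P.[a] <= Q.[b].
  rewrite ltW // (lt_trans PaPb) // PQ // => i.
  by apply: lt_trans ab; apply: fst_zeros_lt_mass.
have H0 : Q - P != 0 by apply: contraTneq Ha => ->; rewrite horner0 ltxx.
have sH : (size (Q - P)%R <= n.+1)%N.
  apply/leq_sizeP => l; rewrite leq_eqVlt => /orP[/eqP<-|nl].
    have lc (y : 'I_n.+1 -> R) : (\prod_i ('X - (y i)%:P))`_n.+1 = 1.
      have := monic_prod_XsubC (index_enum 'I_n.+1) xpredT y.
      by rewrite monicE lead_coefE size_prod_sub => /eqP.
    by rewrite coefB !lc subrr.
  by rewrite coefB !nth_default ?subrr // size_prod_sub.
have [r [rH r1 r2 r3]] := sign_matching a H0.
have r0 : r != 0 by apply: contraTneq (r1 _ ab) => ->; rewrite horner0 ltxx.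
have /andP[ra rab] := r2 _ _ (lexx a) (ltW ab).
case: r3 => r3; last first.
  (* r (Q - P) <= 0 at a forces r(a) = 0, but zeros of r are zeros of Q - P. *)
  have := r3 a (lexx a); rewrite pmulr_lle0 // => ra'.
  have : root (Q - P) a.
    by rewrite -dvdp_XsubCl (dvdp_trans _ rH) // dvdp_XsubCl rootE eq_le ra ra'.
  by rewrite rootE gt_eqF.
exfalso; have [||_] := key (c := 1) (d := 1) (q := r).
- by rewrite (leq_trans _ sH) // dvdp_leq.
- by move=> u uM; rewrite !mul1r -hornerN -hornerD r3 // ltW.
rewrite !scale1r => /(_ r0 H0); rewrite !mul1r ltNge => /negP; apply.
by rewrite ler_pM ?phi_ge0 ?phi_mono // ltW.
Qed.
End MassesOnTheRight.

(** Under x -> -x the monic polynomial with zeros x_i becomes (-1)^(n+1) P(-X),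
whose ordered zeros are the - x_(n-i); the two masses, hence P and Q, are
exchanged.  Since phi is odd, the inequality for (c, d, q) follows from the
original one for (- d e, - c e, q(-X)), where e = (-1)^(n+1). *)
Lemma mass_inequality_reflect (R : rcfType) (n : nat) (phi : R -> R)
    (S : R -> Prop) (x z : 'I_n.+1 -> R) (a b : R) :
  (forall u, phi (- u) = - phi u) ->
  mass_inequality n phi S
    (\prod_i ('X - (x i)%:P)) (\prod_i ('X - (z i)%:P)) a b ->
  mass_inequality n phi (fun u => S (- u))
    (\prod_i ('X - (- z (rev_ord i))%:P)) (\prod_i ('X - (- x (rev_ord i))%:P))
    (- b) (- a).
Proof.
move=> phiN key c d q sq qS.
have EP (y : 'I_n.+1 -> R) : \prod_i ('X - (- y (rev_ord i))%:P) =
    (-1) ^+ n.+1 *: ((\prod_i ('X - (y i)%:P)) \Po - 'X).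
  rewrite rmorph_prod /= [in RHS](reindex_inj rev_ord_inj) /=.
  rewrite -mul_polyC rmorphXn rmorphN1 -[X in _ ^+ X](card_ord n.+1) -prodrN.
  apply: eq_bigr => i _; rewrite comp_polyB comp_polyX comp_polyC polyCN.
  by ring.
have E (y : 'I_n.+1 -> R) u :
    (\prod_i ('X - (- y (rev_ord i))%:P)).[u] =
    (-1) ^+ n.+1 * (\prod_i ('X - (y i)%:P)).[- u].
  by rewrite EP hornerZ horner_comp hornerN hornerX.
set P := \prod_i ('X - (x i)%:P) in key EP E *.
set Q := \prod_i ('X - (z i)%:P) in key EP E *.
set e : R := (-1) ^+ n.+1 in EP E *.
have ee : e * e = 1 by rewrite -expr2 sqrr_sign.
have sq' : (size (q \Po - 'X)%R <= n.+1)%N.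
  by rewrite size_comp_poly2 // size_polyN size_polyX.
have qE u : (q \Po - 'X).[u] = q.[- u] by rewrite horner_comp hornerN hornerX.
have [|le_key lt_key] := key (- (d * e)) (- (c * e)) _ sq'.
  move=> u Su; have := qS (- u); rewrite opprK => /(_ Su).
  rewrite !E opprK qE; congr (0 <= _ * _); ring.
have F1 : q.[- b] * phi (d * (e * Q.[b])) = - (q.[- b] * phi (- (d * e) * Q.[b])).
  by rewrite mulNr phiN mulrN opprK mulrA.
have F2 : q.[- a] * phi (c * (e * P.[a])) = - (q.[- a] * phi (- (c * e) * P.[a])).
  by rewrite mulNr phiN mulrN opprK mulrA.
rewrite !E !opprK F1 F2 lerN2 ltrN2; move: le_key lt_key; rewrite !qE.
split=> // q0 H0; apply: lt_key.
  by rewrite comp_poly2_eq0 // size_polyN size_polyX.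
apply: contraNneq H0 => H1; rewrite !EP !scalerA.
have -> : (c * e) *: (P \Po - 'X) - (d * e) *: (Q \Po - 'X) =
    ((- (d * e)) *: Q - (- (c * e)) *: P) \Po - 'X.
  rewrite comp_polyB !comp_polyZ !scaleNr opprK addrC; congr (_ + _).
by rewrite H1 comp_poly0.
Qed.

Theorem zeros_lt_masses_left (R : rcfType) (n : nat) (phi : R -> R)
    (x z : 'I_n.+1 -> R) (a b : R) :
  {mono phi : u v / u <= v} -> (forall u, phi (- u) = - phi u) ->
  (forall i j : 'I_n.+1, (i < j)%N -> x i < x j) ->
  (forall i j : 'I_n.+1, (i < j)%N -> z i < z j) ->
  a < b ->
  mass_inequality n phi (fun u => b < u)
    (\prod_i ('X - (x i)%:P)) (\prod_i ('X - (z i)%:P)) a b ->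
  forall k, x k < z k.
Proof.
move=> phi_mono phiN xi zi ab key k.
have phi0 : phi 0 = 0.
  by have /eqP := phiN 0; rewrite oppr0 -subr_eq0 opprK -mulr2n mulrn_eq0 => /eqP.
have rev_inc (y : 'I_n.+1 -> R) : (forall i j : 'I_n.+1, (i < j)%N -> y i < y j) ->
    forall i j : 'I_n.+1, (i < j)%N -> - y (rev_ord i) < - y (rev_ord j).
  move=> yi i j ij; rewrite ltrN2 yi //=.
  by have := ltn_ord j; move: ij; lia.
rewrite -ltrN2 -(rev_ordK k).
apply: (zeros_lt_masses_right (a := - b) (b := - a) phi_mono phi0
  (rev_inc _ zi) (rev_inc _ xi)).
  by rewrite ltrN2.
move=> c d q sq qS; apply: (mass_inequality_reflect phiN key) => // u Su.
by apply: qS; rewrite ltrNr.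
Qed.

Local Open Scope classical_set_scope.
Local Open Scope ring_scope.

(** * The signed power *)

(** The derivative of |u|^p / p, in the form u |u|^(p-2), which makes
multiplicativity and oddness immediate. *)
Definition signed_powR (R : realType) (p u : R) : R := u * `|u| `^ (p - 2).

Section SignedPower.
Variables (R : realType) (p : R).
Hypothesis p2 : 2 <= p.
Local Notation phi := (signed_powR p).

Lemma signed_powRN u : phi (- u) = - phi u.
Proof. by rewrite /phi normrN mulNr. Qed.

Lemma signed_powR0 : phi 0 = 0.
Proof. by rewrite /phi mul0r. Qed.

Lemma signed_powRM u v : phi (u * v) = phi u * phi v.
Proof. by rewrite /phi normrM powRM ?normr_ge0 // mulrACA. Qed.

Lemma ger0_signed_powR u : 0 <= u -> phi u = u `^ (p - 1).
Proof.
move=> u0; have p1 : 0 < p - 1 by move: p2; lra.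
rewrite /phi ger0_norm // -(mulr_powRB1 u0 p1).
by congr (_ * _ `^ _); ring.
Qed.

Lemma normr_signed_powR u : `|phi u| = phi `|u|.
Proof. by rewrite /phi normrM normr_id (ger0_norm (powR_ge0 _ _)). Qed.

Lemma signed_powR_mul_id u : phi u * u = `|u| `^ p.
Proof.
have p0 : 0 < p by move: p2; lra.
have p1 : 0 < p - 1 by move: p2; lra.
have -> : phi u * u = `|u| * (`|u| * `|u| `^ (p - 2)).
  by rewrite mulrA -expr2 -normrX ger0_norm ?sqr_ge0 // /phi expr2; ring.
rewrite -(mulr_powRB1 (normr_ge0 u) p0) -(mulr_powRB1 (normr_ge0 u) p1).
by congr (_ * (_ * _ `^ _)); ring.
Qed.

Lemma signed_powR_mono : {mono phi : u v / u <= v}.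
Proof.
have p1 : 0 < p - 1 by move: p2; lra.
have pos u v : 0 <= u -> u < v -> phi u < phi v.
  move=> u0 uv; have v0 : 0 <= v by rewrite ltW // (le_lt_trans u0).
  by rewrite !ger0_signed_powR // gt0_ltr_powR // ?nnegrE.
apply: le_mono => u v uv; have [u0|u0] := leP 0 u; first exact: pos.
have [v0|v0] := leP v 0.
  by rewrite -ltrN2 -!signed_powRN pos ?oppr_ge0 // ltrN2.
apply: (@lt_trans _ _ 0); last by rewrite -{1}signed_powR0 pos.
by rewrite -oppr_gt0 -signed_powRN -{1}signed_powR0 pos // oppr_gt0.
Qed.

(** Young's inequality with exponents p / (p - 1) and p.  It is the gradient
inequality of the convex function |.|^p, with the tangent taken at u. *)
Lemma signed_powR_young u v : p * (phi u * v) <= (p - 1) * `|u| `^ p + `|v| `^ p.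
Proof.
have p0 : 0 < p by move: p2; lra.
have p1 : 0 < p - 1 by move: p2; lra.
have q0 : 0 < p / (p - 1) by rewrite divr_gt0.
apply: (@le_trans _ _ (p * (`|u| `^ (p - 1) * `|v|))).
  by rewrite ler_pM2l // -ger0_signed_powR // -normr_signed_powR -normrM ler_norm.
have pq : (p / (p - 1))^-1 + p^-1 = 1.
  by field; rewrite !gt_eqF //.
have := conjugate_powR (powR_ge0 `|u| (p - 1)) (normr_ge0 v) q0 p0 pq.
rewrite -powRrM (_ : (p - 1) * (p / (p - 1)) = p); last first.
  by field; rewrite gt_eqF.
rewrite -(ler_pM2l p0) => /le_trans; apply; rewrite le_eqVlt; apply/orP; left.
by apply/eqP; field; rewrite !gt_eqF.
Qed.

Lemma continuous_signed_powR : continuous phi.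
Proof.
move=> u; have [->|u0] := eqVneq u 0.
  apply/cvgrPdist_le => e e0; rewrite signed_powR0; near=> v.
  rewrite sub0r normrN normr_signed_powR.
  have v1 : `|v| <= 1.
    by near: v; exact: (nbhs0_le (V := R^o) ltr01).
  apply: (@le_trans _ _ `|v|); last first.
    by near: v; exact: (nbhs0_le (V := R^o) e0).
  rewrite /phi normr_id -[leRHS]mulr1 ler_wpM2l //.
  rewrite -[leRHS](powRr0 `|v|).
  have [->|v0] := eqVneq v 0.
    rewrite normr0 powRr0; have [->|r] := eqVneq (p - 2) 0; first by rewrite powRr0.
    by rewrite powR0.
  by apply: ger_powR; rewrite ?normr_gt0 ?v0 //= subr_ge0.
have -> : phi = (fun v => v * (`|v| `^ (p - 2))) by [].
apply: cvgM; first exact: cvg_id.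
apply: (@continuous_comp _ _ _ (fun v : R => `|v|) (fun w => w `^ (p - 2))).
  exact: norm_continuous.
apply: differentiable_continuous; apply/derivable1_diffP.
by apply: derivable_powR; rewrite in_itv /= normr_gt0 u0.
Unshelve. all: by end_near.
Qed.
End SignedPower.

(** * Extremality and the mass inequality *)

Section MassPlusMeasure.
Variables (R : realType) (p : R) (A : set R) (alpha : borel_measure R).
Variable (j : {posnum R}).
Hypotheses (p2 : 2 <= p) (cA : compact A).
Hypotheses (alphaA : (alpha A < +oo)%E) (alphaCA : alpha (~` A) = 0%E).
Hypothesis alpha_inf : forall s : seq R, (0 < alpha (A `\` [set` s]))%E.

Let mA : measurable (A : set (measurableTypeR R)).
Proof. exact: compact_measurable. Qed.

Lemma integrable_continuous (f : R -> R) : continuous f ->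
  alpha.-integrable A (EFin \o f).
Proof.
move=> cf; apply: measurable_bounded_integrable => //.
  by apply: measurable_funTS; apply: continuous_measurable_fun.
have /compact_bounded [M [Mr H]] : compact (f @` A).
  by apply: continuous_compact => //; apply: continuous_subspaceT.
exists M; split => // N MN x Ax; apply: H MN _ _.
by exists x.
Qed.

(** Integration against alpha + j delta_a, as a real number. *)
Definition mass_functional (a : R) (f : R -> R) : R :=
  (\int[alpha]_(x in A) f x)%R + j%:num * f a.

Lemma continuous_signed_powR_horner (Q : {poly R}) :
  continuous (fun x => signed_powR p Q.[x]).
Proof.
move=> x; apply: (@continuous_comp _ _ _ (fun x => Q.[x]) (signed_powR p)).
  exact: continuous_horner.
exact: continuous_signed_powR.
Qed.

Lemma poly_Lp_normE a (Q : {poly R}) :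
  (poly_Lp_norm (add_mass alpha j a) p Q `^ p)%E =
  (mass_functional a (fun x => `|Q.[x]| `^ p))%:E.
Proof.
have p0 : p != 0 by rewrite gt_eqF //; move: p2; lra.
have cQ : continuous (fun x => `|Q.[x]| `^ p).
  move=> x; under eq_fun do rewrite -signed_powR_mul_id //.
  by apply: cvgM; [exact: continuous_signed_powR_horner|exact: continuous_horner].
have mQ : measurable_fun setT (fun x : measurableTypeR R => (`|Q.[x]| `^ p)%:E).
  by apply/measurable_EFinP; apply: continuous_measurable_fun.
rewrite /poly_Lp_norm poweR_Lnorm //.
rewrite (eq_integral (fun x : measurableTypeR R => (`|Q.[x]| `^ p)%:E)); last by [].
rewrite ge0_integral_measure_add //.
rewrite ge0_integral_mscale //.
rewrite integral_dirac // diracT mul1e /mass_functional EFinD EFinM; congr (_ + _)%E.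
rewrite (@ge0_negligible_integral _ _ _ alpha setT (~` A)) //.
rewrite setTD setCK /Rintegral fineK //.
  by apply: integrable_fin_num => //; apply: integrable_continuous.
exact: measurableC.
Qed.

Lemma mass_functional_le (a : R) (f g : R -> R) : continuous f -> continuous g ->
  (forall x, f x <= g x) -> mass_functional a f <= mass_functional a g.
Proof.
move=> cf cg fg; rewrite lerD ?ler_wpM2l //.
by apply: le_Rintegral => //; exact: integrable_continuous.
Qed.

Lemma mass_functional_lin (a c : R) (f g : R -> R) : continuous f -> continuous g ->
  mass_functional a (fun x => f x + c * g x) =
  mass_functional a f + c * mass_functional a g.
Proof.
move=> cf cg; rewrite /mass_functional RintegralD //; last 2 first.
- exact: integrable_continuous.
- apply: integrable_continuous => x; apply: cvgM; [exact: cvg_cst|exact: cg].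
rewrite RintegralZl //; last exact: integrable_continuous.
by ring.
Qed.

Lemma minimal_monic_le a n (P Q : {poly R}) :
  minimal_monic (add_mass alpha j a) p n.+1 P -> Q \is monic -> size Q = n.+2 ->
  mass_functional a (fun x => `|P.[x]| `^ p) <=
  mass_functional a (fun x => `|Q.[x]| `^ p).
Proof.
move=> [_ _ minP] mQ sQ; rewrite -lee_fin -!poly_Lp_normE.
have p0 : 0 <= p by move: p2; lra.
have N_itv (T : {poly R}) : poly_Lp_norm (add_mass alpha j a) p T \in `[0%E, +oo%E].
  by rewrite in_itv /= leey andbT; exact: Lnorm_ge0.
by apply: gt0_ler_poweR => //; exact: minP.
Qed.

Lemma continuous_mul_signed_powR (q Q : {poly R}) :
  continuous (fun x => q.[x] * signed_powR p Q.[x]).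
Proof.
by move=> x; apply: cvgM; [exact: continuous_horner|exact: continuous_signed_powR_horner].
Qed.

(** With V = P + e q, the gradient inequality at V gives
|V|^p <= |P|^p + p e q phi(V) pointwise.  Integrating and using that P is
extremal leaves the stated sign.  The tangent is taken at V rather than at P, so
no second order estimate is needed: only the limit e -> 0 remains. *)
Lemma variation_ge0 a n (P q : {poly R}) e :
  minimal_monic (add_mass alpha j a) p n.+1 P -> (size q <= n.+1)%N -> 0 < e ->
  0 <= mass_functional a (fun x => q.[x] * signed_powR p (P + e *: q).[x]).
Proof.
move=> minP sq e0; set V := P + e *: q.
have p0 : 0 < p by move: p2; lra.
have [mP sP _] := minP.
have seq : (size (e *: q)%R < size P)%N.
  by rewrite sP ltnS (leq_trans (size_scale_leq _ _)).
have mV : V \is monic by rewrite monicE lead_coefDl // -monicE.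
have sV : size V = n.+2 by rewrite size_polyDl.
have cpow (Q : {poly R}) : continuous (fun x => `|Q.[x]| `^ p).
  move=> x; under eq_fun do rewrite -signed_powR_mul_id //.
  by apply: cvgM; [exact: continuous_signed_powR_horner|exact: continuous_horner].
have := minimal_monic_le minP mV sV.
have cR : continuous (fun x => `|P.[x]| `^ p + (p * e) * (q.[x] * signed_powR p V.[x])).
  move=> x; apply: cvgD; first exact: cpow.
  by apply: cvgM; [exact: cvg_cst|exact: continuous_mul_signed_powR].
have /[swap]/le_trans/[apply] : mass_functional a (fun x => `|V.[x]| `^ p) <=
    mass_functional a (fun x => `|P.[x]| `^ p + (p * e) * (q.[x] * signed_powR p V.[x])).
  apply: mass_functional_le => // x; have := signed_powR_young p2 V.[x] P.[x].
  have -> : signed_powR p V.[x] * P.[x] = `|V.[x]| `^ p - e * (q.[x] * signed_powR p V.[x]).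
    by rewrite -signed_powR_mul_id // {3}/V hornerD hornerZ; ring.
  lra.
rewrite mass_functional_lin //; last exact: continuous_mul_signed_powR.
by rewrite lerDl pmulr_rge0 // mulr_gt0.
Qed.

Lemma dominated_mass_functional a (f_ : nat -> R -> R) (f g : R -> R) :
  (forall k, continuous (f_ k)) -> continuous f -> continuous g ->
  (forall x, f_ ^~ x @ \oo --> f x) -> (forall k x, `|f_ k x| <= g x) ->
  (fun k => mass_functional a (f_ k)) @ \oo --> mass_functional a f.
Proof.
move=> cf_ cf cg f_f fg.
apply: cvgD; last by apply: cvgM; [exact: cvg_cst|exact: f_f].
apply: fine_cvg; rewrite fineK; last first.
  by apply: integrable_fin_num => //; exact: integrable_continuous.
have [|||||_ _ //] := @dominated_convergence _ _ _ alpha A mA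
   (fun k => EFin \o f_ k) (EFin \o f) (EFin \o g).
- by move=> k; have /integrableP[] := integrable_continuous (cf_ k).
- by have /integrableP[] := integrable_continuous cf.
- by apply: aeW => x _; apply/fine_cvgP; split; [exact: nearW|exact: f_f].
- exact: integrable_continuous.
- by apply: aeW => x k _; rewrite /= lee_fin.
Qed.

(** Let e = 1/(k+1) tend to 0 in variation_ge0, by dominated convergence, and
apply the result to q and to - q. *)
Lemma orthogonality a n (P q : {poly R}) :
  minimal_monic (add_mass alpha j a) p n.+1 P -> (size q <= n.+1)%N ->
  mass_functional a (fun x => q.[x] * signed_powR p P.[x]) = 0.
Proof.
move=> minP.
have ge0 (r : {poly R}) : (size r <= n.+1)%N ->
    0 <= mass_functional a (fun x => r.[x] * signed_powR p P.[x]).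
  move=> sr; pose f_ k x := r.[x] * signed_powR p (P + k.+1%:R^-1 *: r).[x].
  have cvL : (fun k => mass_functional a (f_ k)) @ \oo -->
      mass_functional a (fun x => r.[x] * signed_powR p P.[x]).
    apply: (@dominated_mass_functional _ _ _
      (fun x => `|r.[x]| * signed_powR p (`|P.[x]| + `|r.[x]|))).
    - by move=> k; exact: continuous_mul_signed_powR.
    - exact: continuous_mul_signed_powR.
    - move=> x; apply: cvgM.
        by apply: continuous_comp; [exact: continuous_horner|exact: norm_continuous].
      apply: (@continuous_comp _ _ _ (fun x => `|P.[x]| + `|r.[x]|)
        (signed_powR p)); last exact: continuous_signed_powR.
      apply: cvgD; apply: continuous_comp; by [exact: continuous_horner|exact: norm_continuous].
    - move=> x; apply: cvgM; first exact: cvg_cst.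
      apply: (@cvg_comp _ _ _ (fun k => (P + k.+1%:R^-1 *: r).[x]) (signed_powR p));
        last exact: continuous_signed_powR.
      have -> : (fun k => (P + k.+1%:R^-1 *: r).[x]) =
          (fun k => P.[x] + k.+1%:R^-1 * r.[x]).
        by apply/funext => k; rewrite hornerD hornerZ.
      suff : P.[x] + k.+1%:R^-1 * r.[x] @[k --> \oo] --> P.[x] + 0 * r.[x].
        by rewrite mul0r addr0.
      apply: cvgD; first exact: cvg_cst.
      by apply: cvgM; [exact: cvg_harmonic|exact: cvg_cst].
    - move=> k x; rewrite normrM ler_wpM2l // normr_signed_powR signed_powR_mono //.
      rewrite hornerD hornerZ (le_trans (ler_normD _ _)) // lerD2l normrM.
      rewrite ler_piMl // ger0_norm ?invr_ge0 // invf_le1 // ler1n //.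
  rewrite -(cvg_lim _ cvL) //; apply: limr_ge; first by apply/cvgP: cvL.
  apply: nearW => k; apply: variation_ge0 minP sr _; rewrite invr_gt0 //.
move=> sq; apply/eqP; rewrite eq_le ge0 // andbT.
have : 0 <= mass_functional a (fun x => (- q).[x] * signed_powR p P.[x]).
  by rewrite ge0 // size_polyN.
suff -> : mass_functional a (fun x => (- q).[x] * signed_powR p P.[x]) =
  - mass_functional a (fun x => q.[x] * signed_powR p P.[x]) by rewrite oppr_ge0.
(* Additivity with the factor -2 yields oddness, as f + (-2) f = - f. *)
have := mass_functional_lin a (-2) (@continuous_mul_signed_powR q P)
  (@continuous_mul_signed_powR q P).
under [X in mass_functional _ X]eq_fun => x.
  rewrite (_ : _ + _ = (- q).[x] * signed_powR p P.[x]); last by rewrite hornerN; ring.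
  over.
by move=> ->; ring.
Qed.

Lemma ex_roots (G : {poly R}) : G != 0 ->
  exists s : seq R, forall u, root G u -> u \in s.
Proof.
move: {2}(size G) (leqnn (size G)) => m; elim: m G => [|m IH] G.
  by rewrite leqn0 size_poly_eq0 => ->.
move=> sG G0.
have [[r rG]|noroot] := pselect (exists r, root G r); last first.
  by exists [::] => u ru; case: noroot; exists u.
have [H GE] := factor_theorem _ _ rG.
have H0 : H != 0 by apply: contraNneq G0; rewrite GE => ->; rewrite mul0r.
have sH : (size H <= m)%N.
  by move: sG; rewrite GE size_Mmonic ?monicXsubC // size_XsubC addn2.
have [s Hs] := IH _ sH H0; exists (r :: s) => u.
by rewrite GE rootM root_XsubC in_cons => /orP[/Hs->|->//]; rewrite orbT.
Qed.

(** A nonnegative integrand with zero integral vanishes almost everywhere, and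
alpha charges the part of A outside any finite set, so f has a zero in A outside
any finite set; a nonzero G has only finitely many roots. *)
Lemma integral_eq0_poly (f : R -> R) (G : {poly R}) : continuous f ->
  (forall x, A x -> 0 <= f x) -> (forall x, A x -> f x = 0 -> root G x) ->
  (\int[alpha]_(x in A) f x)%R = 0 -> G = 0.
Proof.
move=> cf f0 fG; apply: contra_eq => /ex_roots[s Gs].
apply/negP => /eqP If.
have intf := integrable_continuous cf.
have : (\int[alpha]_(x in A) `|(EFin \o f) x| = 0)%E.
  transitivity (\int[alpha]_(x in A) (EFin \o f) x)%E.
    by apply: eq_integral => x /set_mem Ax; rewrite /= ger0_norm ?f0.
  have fI := integrable_fin_num mA intf.
  by rewrite -(fineK fI) -[fine _]/(Rintegral _ _ _) If.
have /integrableP[mf _] := intf.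
move/(ae_eq_integral_abs alpha mA mf) => [N [mN N0 subN]].
have := alpha_inf s; rewrite ltNge => /negP; apply; rewrite -N0.
apply: le_measure; rewrite ?inE //.
  apply: measurableD => //.
  by apply: compact_measurable; apply: finite_compact; exact: finite_seq.
move=> x [Ax xs]; apply: subN => /(_ Ax) /= [fx0].
by apply: xs; apply: Gs; exact: fG.
Qed.

(** Orthogonality of q to phi(P) and to phi(Q), multiplied by phi(d) and phi(c)
and subtracted, turns the integral of q (phi(c Q) - phi(d P)) over A into the
difference of the mass terms.  Monotonicity of phi makes the integrand
nonnegative; if the integral is zero, q (c Q - d P) is the zero polynomial. *)
Lemma minimal_mass_inequality a b n (P Q : {poly R}) (S : R -> Prop) :
  (forall x, A x -> S x) ->
  minimal_monic (add_mass alpha j a) p n.+1 P ->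
  minimal_monic (add_mass alpha j b) p n.+1 Q ->
  mass_inequality n (signed_powR p) S P Q a b.
Proof.
move=> AS minP minQ c d q sq qS.
pose f x := signed_powR p c * (q.[x] * signed_powR p Q.[x]) +
  (- signed_powR p d) * (q.[x] * signed_powR p P.[x]).
have fE x : f x = q.[x] * (signed_powR p (c * Q.[x]) - signed_powR p (d * P.[x])).
  by rewrite /f !signed_powRM; ring.
have cf : continuous f.
  move=> x; apply: cvgD; apply: cvgM;
    by first [exact: cvg_cst | exact: continuous_mul_signed_powR].
have f0 x : A x -> 0 <= f x.
  move=> /AS /qS; rewrite fE; case: (ltgtP q.[x] 0) => [q0|q0|->]; last by rewrite !mul0r.
    by rewrite !nmulr_rge0 // !subr_le0 signed_powR_mono.
  by rewrite !pmulr_rge0 // !subr_ge0 signed_powR_mono.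
have oP := orthogonality minP sq; have oQ := orthogonality minQ sq.
have If : (\int[alpha]_(x in A) f x)%R =
    j%:num * (q.[a] * signed_powR p (d * P.[a]) - q.[b] * signed_powR p (c * Q.[b])).
  have iP := integrable_continuous (@continuous_mul_signed_powR q P).
  have iQ := integrable_continuous (@continuous_mul_signed_powR q Q).
  have iZ (e : R) (g : R -> R) : continuous g ->
      alpha.-integrable A (EFin \o (fun x => e * g x)).
    move=> cg; apply: integrable_continuous => x.
    by apply: cvgM; [exact: cvg_cst|exact: cg].
  rewrite RintegralD //; [|exact/iZ/continuous_mul_signed_powR..].
  rewrite !RintegralZl // !signed_powRM; move: oP oQ; rewrite /mass_functional.
  move=> /eqP; rewrite addr_eq0 => /eqP-> /eqP; rewrite addr_eq0 => /eqP->.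
  by ring.
have I0 : 0 <= (\int[alpha]_(x in A) f x)%R by apply: Rintegral_ge0.
move: (I0); rewrite If pmulr_rge0 // subr_ge0 => le; split=> // q0 H0.
rewrite lt_neqAle le andbT; apply/negP => /eqP E.
have := mulf_neq0 q0 H0; apply/negP; rewrite negbK; apply/eqP.
apply: (integral_eq0_poly cf f0); last by rewrite If E subrr mulr0.
move=> x Ax /eqP; rewrite fE mulf_eq0 rootM => /orP[|]; first by rewrite rootE => ->.
rewrite subr_eq0 eq_le !signed_powR_mono // -eq_le => /eqP h.
by rewrite [X in _ || X]rootE hornerD hornerN !hornerZ h subrr eqxx orbT.
Qed.

End MassPlusMeasure.

(** * From the data of the theorem to the comparison *)

Lemma ordered_zeros_prod (R : realType) (n : nat) (Q : {poly R}) (x : 'I_n -> R) :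
  Q \is monic -> size Q = n.+1 -> ordered_zeros Q x ->
  Q = \prod_i ('X - (x i)%:P).
Proof.
move=> mQ sQ [xi rx].
have inj : injective x.
  move=> i j /eqP; apply: contraTeq; rewrite -val_eqE neq_ltn => /orP[] /xi h.
    by rewrite lt_eqF.
  by rewrite gt_eqF.
have := @all_roots_prod_XsubC _ Q [seq x i | i <- enum 'I_n].
rewrite size_map size_enum_ord sQ (monicP mQ) scale1r big_map big_enum => -> //.
- by apply/allP => _ /mapP[i _ ->]; apply/rx; exists i.
- by rewrite uniq_rootsE map_inj_uniq ?enum_uniq.
Qed.

Lemma outside_convex_hull (R : realType) (A : set R) v :
  (~` convex_hull A) v -> (forall u, A u -> u < v) \/ (forall u, A u -> v < u).
Proof.
move=> vA; apply: contrapT => /not_orP[/existsNP[b /not_implyP[Ab bv]]].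
move=> /existsNP[a /not_implyP[Aa av]].
move/negP: bv; move/negP: av; rewrite -!leNgt => av bv; apply: vA.
move=> C [/= cC AC].
have Ca := AC _ Aa; have Cb := AC _ Ab.
have [ab|ab] := eqVneq a b.
  by have -> : v = a by apply/eqP; rewrite eq_le av ab bv.
have {}ab : 0 < b - a by rewrite subr_gt0 lt_neqAle ab (le_trans av bv).
pose l := (b - v) / (b - a).
have l0 : 0 <= l by rewrite divr_ge0 ?(ltW ab) // subr_ge0.
have l1 : l <= 1 by rewrite ler_pdivrMr // mul1r lerD2l lerN2.
have := cC a b (Itv01 l0 l1); rewrite !inE => /(_ Ca Cb).
suff E : conv (Itv01 l0 l1) (a : R^o) (b : R^o) = v.
  by move=> H; rewrite -E.
change (l * a + (1 - l) * b = v); rewrite /l; field.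
by rewrite gt_eqF.
Qed.

(** As omega is positive on A, an alpha-null subset of A is nu-null.  If alpha
did not charge the complement of the finite set s in A, neither would nu, and
the support of nu would be contained in s. *)
Lemma density_finite_carried_infinite (R : realType) (A : set R)
    (nu alpha : borel_measure R) (omega : R -> R) :
  compact A -> nontrivial_radon_on A nu -> (forall x, A x -> 0 < omega x) ->
  nu.-integrable A (EFin \o omega) -> has_density A nu omega alpha ->
  [/\ (alpha A < +oo)%E, alpha (~` A) = 0%E &
      forall s : seq R, (0 < alpha (A `\` [set` s]))%E].
Proof.
move=> cA [rnu nuA inf] w0 iw dens.
have mA : measurable (A : set (measurableTypeR R)) by exact: compact_measurable.
split.
- rewrite dens // setIid ltey_eq; apply/orP; left.
  exact: integrable_fin_num.
- by rewrite dens ?setICl ?integral_set0 //; exact: measurableC.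
move=> s.
have cs : closed [set` s].
  apply: compact_closed; first exact: Rhausdorff.
  by apply: finite_compact; exact: finite_seq.
have ms : measurable ([set` s] : set (measurableTypeR R)).
  exact: closed_measurable.
have mE : measurable (A `\` [set` s] : set (measurableTypeR R)) by exact: measurableD.
rewrite lt0e measure_ge0 andbT; apply/eqP => a0; apply: inf.
apply: (@sub_finite_set _ _ [set` s]); last exact: finite_seq.
move=> x sx; apply: contrapT => xs.
have := sx (~` [set` s]) (closed_openC cs) xs.
rewrite ltNge => /negP; apply.
move: a0; rewrite dens // (_ : _ `&` A = A `\` [set` s]); last first.
  by apply/setIidl => u [].
move=> I0.
have iE : nu.-integrable (A `\` [set` s]) (EFin \o omega).
  exact: (integrableS mA mE (@subDsetl _ _ _) iw).
have /integrableP[mf _] := iE.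
have : (\int[nu]_(x in A `\` [set` s]) `|(EFin \o omega) x| = 0)%E.
  rewrite -[RHS]I0; apply: eq_integral => u /set_mem [Au _].
  by rewrite /= gtr0_norm ?w0.
move/(ae_eq_integral_abs nu mE mf) => [N [mN N0 subN]].
have : (nu (~` [set` s]) <= nu ((~` A) `|` N))%E.
  apply: le_measure; rewrite ?inE.
  - exact: measurableC.
  - by apply: measurableU => //; exact: measurableC.
  move=> u us; have [Au|Au] := pselect (A u); last by left.
  right; apply: subN => /(_ (conj Au us)) [] wu.
  by have := w0 u Au; rewrite wu ltxx.
by rewrite null_set_setU //; exact: measurableC.
Qed.

Lemma zeros_lt_of_mass_lt (R : realType) (p : R) (A : set R)
    (alpha : borel_measure R) (j : {posnum R}) (n : nat) (a b : R)
    (P Q : {poly R}) (x z : 'I_n.+1 -> R) :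
  2 <= p -> compact A -> (alpha A < +oo)%E -> alpha (~` A) = 0%E ->
  (forall s : seq R, (0 < alpha (A `\` [set` s]))%E) ->
  a < b ->
  (forall u, A u -> u < a) \/ (forall u, A u -> b < u) ->
  minimal_monic (add_mass alpha j a) p n.+1 P -> ordered_zeros P x ->
  minimal_monic (add_mass alpha j b) p n.+1 Q -> ordered_zeros Q z ->
  forall k, x k < z k.
Proof.
move=> p2 cA Afin AC Ainf ab side minP zP minQ zQ.
have [mP sP _] := minP; have [mQ sQ _] := minQ.
have PE := ordered_zeros_prod mP sP zP; have QE := ordered_zeros_prod mQ sQ zQ.
case: side => AS.
  have := minimal_mass_inequality p2 cA Afin AC Ainf AS minP minQ.
  rewrite PE QE; apply: zeros_lt_masses_right => //;
    [exact: signed_powR_mono|exact: signed_powR0|exact: zP.1|exact: zQ.1].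
have := minimal_mass_inequality p2 cA Afin AC Ainf AS minP minQ.
rewrite PE QE; apply: zeros_lt_masses_left => //;
  [exact: signed_powR_mono|exact: signed_powRN|exact: zP.1|exact: zQ.1].
Qed.

(** If y(s) and y(t) were separated by a point of A, the intermediate value
theorem would make y take that value, which lies in the hull. *)
Lemma same_side_of_hull (R : realType) (A : set R) (y : R -> R) (s t : R) :
  s <= t -> {within `[s, t], continuous y} ->
  (forall u, s <= u <= t -> (~` convex_hull A) (y u)) ->
  (forall u, A u -> u < y s /\ u < y t) \/ (forall u, A u -> y s < u /\ y t < u).
Proof.
move=> st cy out.
have cross v : A v -> Num.min (y s) (y t) <= v <= Num.max (y s) (y t) -> False.
  move=> Av /(IVT st cy) [c]; rewrite in_itv /= => sct yc.
  apply: (out c sct); rewrite yc; exact: sub_smallest Av.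
have ss : s <= s <= t by rewrite lexx.
have tt : s <= t <= t by rewrite lexx st.
case: (outside_convex_hull (out s ss)) => As;
  case: (outside_convex_hull (out t tt)) => At.
- by left=> u Au; split; [exact: As|exact: At].
- right=> u Au; exfalso; apply: (cross u Au).
  by rewrite ge_min le_max (ltW (As u Au)) (ltW (At u Au)) ?orbT.
- right=> u Au; exfalso; apply: (cross u Au).
  by rewrite ge_min le_max (ltW (As u Au)) (ltW (At u Au)) ?orbT.
- by right=> u Au; split; [exact: As|exact: At].
Qed.

Theorem mainTheorem2 (R : realType) (p : R) (n : nat) (hp : 2 <= p)
    (A : set R) (hA : compact A)
    (nu : borel_measure R) (hnu : nontrivial_radon_on A nu)
    (omega : R -> R) (homega : forall x, A x -> 0 < omega x)
    (iomega : nu.-integrable A (EFin \o omega))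
    (alpha : borel_measure R) (halpha : has_density A nu omega alpha)
    (j : {posnum R})
    (U : set R) (oU : open U) (iU : is_interval U)
    (y : R -> R) (hy : C1_on U y)
    (P : R -> {poly R})
    (hP : forall t, U t -> minimal_monic (add_mass alpha j (y t)) p n.+1 (P t))
    (x : 'I_n.+1 -> R -> R)
    (hx : forall t, U t -> ordered_zeros (P t) (fun k => x k t)) :
  (forall k, strictly_decreasing_on (Bminus A U y) (x k)) /\
  (forall k, strictly_increasing_on (Bplus A U y) (x k)).
Proof.
have [Afin AC Ainf] := density_finite_carried_infinite hA hnu homega iomega halpha.
have cmp s t k : U s -> U t -> y s < y t ->
    (forall u, A u -> u < y s) \/ (forall u, A u -> y t < u) -> x k s < x k t.
  move=> Us Ut yst side.
  exact: (zeros_lt_of_mass_lt hp hA Afin AC Ainf yst side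
    (hP s Us) (hx s Us) (hP t Ut) (hx t Ut)).
have cont s t (I : set R) : is_interval I -> I `<=` U -> I s -> I t ->
    {within `[s, t], continuous y}.
  move=> iI IU Is It; apply: derivable_within_continuous => u.
  rewrite in_itv /= => sut; apply: hy.1; apply: IU; exact: iI sut.
split=> k I iI IB s t Is It st.
- have IU : I `<=` U by move=> u /IB[].
  have sub u : s <= u <= t -> I u by exact: iI.
  have yts : y t < y s.
    apply: (@ltr0_derive1_lt_cc _ y s t); rewrite ?in_itv /= ?lexx ?(ltW st) //.
    + move=> u; rewrite in_itv /= => /andP[su ut]; apply: hy.1; apply: IU.
      by apply: sub; rewrite !ltW.
    + move=> u; rewrite in_itv /= => /andP[su ut].
      by have [|] := IB u; first by apply: sub; rewrite !ltW.
    + exact: cont Is It.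
  apply: cmp => //; [exact: IU|exact: IU|].
  have [|H|H] := same_side_of_hull (A := A) (ltW st) (cont _ _ _ iI IU Is It).
  + by move=> u /sub/IB[].
  + by left=> u /H[].
  + by right=> u /H[].
- have IU : I `<=` U by move=> u /IB[].
  have sub u : s <= u <= t -> I u by exact: iI.
  have yst : y s < y t.
    apply: (@gtr0_derive1_lt_cc _ y s t); rewrite ?in_itv /= ?lexx ?(ltW st) //.
    + move=> u; rewrite in_itv /= => /andP[su ut]; apply: hy.1; apply: IU.
      by apply: sub; rewrite !ltW.
    + move=> u; rewrite in_itv /= => /andP[su ut].
      by have [|] := IB u; first by apply: sub; rewrite !ltW.
    + exact: cont Is It.
  apply: cmp => //; [exact: IU|exact: IU|].
  have [|H|H] := same_side_of_hull (A := A) (ltW st) (cont _ _ _ iI IU Is It).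
  + by move=> u /sub/IB[].
  + by left=> u /H[].
  + by right=> u /H[].
Qed.
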